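(* Let $S$ and $T$ be inverse semigroups and let $(S,T,X,\langle -,-\rangle,[-,-])$ be an equivalence bimodule. Define a ternary operation on the set $X$ by $$\{xyz\} = \langle x,y\rangle z \qquad (x,y,z\in X).$$ Then $(X,\{\})$ is a generalized heap.
   Context: Generalized heap: a set $X$ with a (total) ternary operation $(x,y,z)\mapsto\{xyz\}$ satisfying, for all elements: (A1) $\{xxx\}=x$; (A2) $\{\{x_1x_2x_3\}x_4x_5\}=\{x_1\{x_4x_3x_2\}x_5\}=\{x_1x_2\{x_3x_4x_5\}\}$; (A3) $\{xx\{yyz\}\}=\{yy\{xxz\}\}$; (A4) $\{\{zxx\}yy\}=\{\{zyy\}xx\}$. Modules: for an inverse semigroup $S$, a left $S$-module is a set $X$ with a map $S\times X\to X$, $(s,x)\mapsto sx$, such that $(st)x=s(tx)$ and which is unitary: $SX=X$. Right modules are defined dually. An $(S,T)$-bimodule is a left $S$-module and right $T$-module $X$ with $(sx)t=s(xt)$ for all $s\in S$, $t\in T$, $x\in X$. Equivalence bimodule: for inverse semigroups $S,T$, an equivalence bimodule $(S,T,X,\langle-,-\rangle,[-,-])$ is an $(S,T)$-bimodule $X$ with surjective functions $\langle-,-\rangle\colon X\times X\to S$ and $[-,-]\colon X\times X\to T$ such that for all $x,y,z\in X$, $s\in S$, $t\in T$: (MC1) $\langle sx,y\rangle=s\langle x,y\rangle$; (MC2) $\langle y,x\rangle=\langle x,y\rangle^{-1}$; (MC3) $\langle x,x\rangle x=x$; (MC4) $[x,yt]=[x,y]t$; (MC5) $[x,y]=[y,x]^{-1}$;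 (MC6) $x[x,x]=x$; (MC7) $\langle x,y\rangle z=x[y,z]$. *)

(* Defs.v *)
From HB Require Import structures.
From mathcomp Require Import all_boot.

Set Implicit Arguments.
Unset Strict Implicit.
Unset Printing Implicit Defensive.

Local Open Scope group_scope.

(* The inverse is carried as an operation; it is uniquely determined by the
   last three axioms, so this is the same as requiring every element of a
   semigroup to have exactly one inverse.  We build on [magmaType] rather than
   on [semigroupType] because the latter would require a [choiceType]. *)
HB.mixin Record Magma_isInverseSemigroup S of Magma S := {
  invs : S -> S;
  mulsA : associative (@mul S);
  mulsVK : forall s : S, s * invs s * s = s;
  mulVsV : forall s : S, invs s * s * invs s = invs s;
  invs_uniq : forall s t : S, s * t * s = s -> t * s * t = t -> t = invs s
}.

#[short(type="inverseSemigroupType")]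
HB.structure Definition InverseSemigroup :=
  {S of Magma_isInverseSemigroup S & Magma S}.

Record left_module (S : inverseSemigroupType) (X : Type)
    (lact : S -> X -> X) : Prop := LeftModule {
  lactM : forall s t x, lact (s * t) x = lact s (lact t x);
  lact_unitary : forall x, exists s y, lact s y = x
}.

Record right_module (T : inverseSemigroupType) (X : Type)
    (ract : X -> T -> X) : Prop := RightModule {
  ractM : forall x s t, ract x (s * t) = ract (ract x s) t;
  ract_unitary : forall x, exists y t, ract y t = x
}.

Record bimodule (S T : inverseSemigroupType) (X : Type)
    (lact : S -> X -> X) (ract : X -> T -> X) : Prop := Bimodule {
  bimodule_left : left_module lact;
  bimodule_right : right_module ract;
  lact_ract : forall s x t, ract (lact s x) t = lact s (ract x t)
}.

(* [lform x y] is <x, y> and [rform x y] is [x, y]. *)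
Record equivalence_bimodule (S T : inverseSemigroupType) (X : Type)
    (lact : S -> X -> X) (ract : X -> T -> X)
    (lform : X -> X -> S) (rform : X -> X -> T) : Prop :=
  EquivalenceBimodule {
  equivalence_bimodule_bimodule : bimodule lact ract;
  lform_surj : forall s, exists x y, lform x y = s;
  rform_surj : forall t, exists x y, rform x y = t;
  MC1 : forall s x y, lform (lact s x) y = s * lform x y;
  MC2 : forall x y, lform y x = invs (lform x y);
  MC3 : forall x, lact (lform x x) x = x;
  MC4 : forall x y t, rform x (ract y t) = rform x y * t;
  MC5 : forall x y, rform x y = invs (rform y x);
  MC6 : forall x, ract x (rform x x) = x;
  MC7 : forall x y z, lact (lform x y) z = ract x (rform y z)
}.

Record generalized_heap (X : Type) (h : X -> X -> X -> X) : Prop :=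
  GeneralizedHeap {
  heapA1 : forall x, h x x x = x;
  heapA2l : forall x1 x2 x3 x4 x5,
    h (h x1 x2 x3) x4 x5 = h x1 (h x4 x3 x2) x5;
  heapA2r : forall x1 x2 x3 x4 x5,
    h x1 (h x4 x3 x2) x5 = h x1 x2 (h x3 x4 x5);
  heapA3 : forall x y z, h x x (h y y z) = h y y (h x x z);
  heapA4 : forall x y z, h (h z x x) y y = h (h z y y) x x
}.

(* Main.v *)
Require Import Defs.
From mathcomp Require Import all_boot.

(** In an inverse semigroup idempotents commute, and hence
    [(st)^-1 = t^-1 s^-1]; these two facts carry the whole proof.

    - [heapA1] is [MC3].
    - [heapA2l] and [heapA2r] hold because all three bracketings are the
      action of [<x1, x2> <x3, x4>] on [x5].  For the middle one, [MC1] only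
      pulls scalars out of the first argument of the form, so
      [<x1, <x4, x3> x2>] is flipped by [MC2], and the inverse of a product
      has to be expanded.
    - [heapA3] holds because [<x, x>] and [<y, y>] are idempotents of [S].
    - [heapA4] is the mirror image: [MC7] rewrites [{zxx}] as [z [x, x]], and
      the idempotents [[x, x]] and [[y, y]] of [T] commute. *)

Set Implicit Arguments.
Unset Strict Implicit.

Local Open Scope group_scope.

Lemma invs_idem (S : inverseSemigroupType) (e : S) : e * e = e -> invs e = e.
Proof. by move=> ee; apply/esym/invs_uniq; rewrite !ee. Qed.

Lemma invsK (S : inverseSemigroupType) (s : S) : invs (invs s) = s.
Proof. by apply/esym/invs_uniq; rewrite ?mulVsV ?mulsVK. Qed.

(** With [x] the inverse of [ef], the element [fxe] is also an inverse of [ef],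
    so [x = fxe] by uniqueness.  Then [xx = f (x ef x) e = fxe = x], and an
    idempotent is its own inverse, that is, [x = ef]. *)
Lemma idem_mul (S : inverseSemigroupType) (e f : S) :
  e * e = e -> f * f = f -> (e * f) * (e * f) = e * f.
Proof.
move=> ee ff; set x := invs (e * f).
have efx_ef : e * f * x * (e * f) = e * f by exact: mulsVK.
have x_ef_x : x * (e * f) * x = x by exact: mulVsV.
have fxeE : f * x * e = x.
  apply: invs_uniq.
  - rewrite -[RHS]efx_ef !mulsA.
    by rewrite -(mulsA e f f) ff -(mulsA _ e e) ee.
  - rewrite -[in RHS]x_ef_x !mulsA.
    by rewrite -(mulsA _ e e) ee -(mulsA _ f f) ff.
have xx : x * x = x.
  rewrite -[in LHS]fxeE -[RHS]fxeE -[in RHS]x_ef_x.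
  by rewrite !mulsA.
have efE : e * f = x by rewrite -[LHS]invsK (invs_idem xx).
by rewrite efE.
Qed.

(** Both [ef] and [fe] are idempotent, so [fe] is an inverse of [ef], and [ef]
    is its own inverse. *)
Lemma idem_comm (S : inverseSemigroupType) (e f : S) :
  e * e = e -> f * f = f -> e * f = f * e.
Proof.
move=> ee ff.
have efef := idem_mul ee ff; have fefe := idem_mul ff ee.
rewrite -[LHS](invs_idem efef); apply/esym/invs_uniq.
- by rewrite !mulsA -(mulsA e f f) ff -(mulsA _ e e) ee -mulsA.
- by rewrite !mulsA -(mulsA f e e) ee -(mulsA _ f f) ff -mulsA.
Qed.

(** Commuting the idempotents [s^-1 s] and [t t^-1] shows that [t^-1 s^-1]
    is an inverse of [st]. *)
Lemma invsM (S : inverseSemigroupType) (s t : S) :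
  invs (s * t) = invs t * invs s.
Proof.
have comm : t * invs t * (invs s * s) = invs s * s * (t * invs t).
  by apply: idem_comm; rewrite !mulsA ?mulsVK ?mulVsV.
apply/esym/invs_uniq.
- transitivity (s * (t * invs t * (invs s * s)) * t); first by rewrite !mulsA.
  by rewrite comm !mulsA mulsVK -!mulsA (mulsA t) mulsVK.
- transitivity (invs t * (invs s * s * (t * invs t)) * invs s).
    by rewrite !mulsA.
  by rewrite -comm !mulsA mulVsV -!mulsA (mulsA (invs s)) mulVsV.
Qed.

Section EquivalenceBimodule.

Variables (S T : inverseSemigroupType) (X : Type).
Variables (lact : S -> X -> X) (ract : X -> T -> X).
Variables (lform : X -> X -> S) (rform : X -> X -> T).
Hypothesis HX : equivalence_bimodule lact ract lform rform.

Lemma lform_idem x : lform x x * lform x x = lform x x.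
Proof. by rewrite -(MC1 HX) (MC3 HX). Qed.

Lemma rform_idem x : rform x x * rform x x = rform x x.
Proof. by rewrite -(MC4 HX) (MC6 HX). Qed.

(** The form [<-, ->] is conjugate-linear in its second argument, with inversion as
    the conjugation. *)
Lemma lformZr x s y : lform x (lact s y) = lform x y * invs s.
Proof. by rewrite (MC2 HX) (MC1 HX) invsM -(MC2 HX). Qed.

End EquivalenceBimodule.

Unset Implicit Arguments.
Set Strict Implicit.

Theorem proposition2p2 (S T : inverseSemigroupType) (X : Type)
    (lact : S -> X -> X) (ract : X -> T -> X)
    (lform : X -> X -> S) (rform : X -> X -> T)
    (HX : equivalence_bimodule lact ract lform rform) :
  generalized_heap (fun x y z : X => lact (lform x y) z).
Proof.
have [lM rM] := (lactM (bimodule_left (equivalence_bimodule_bimodule HX)),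
                 ractM (bimodule_right (equivalence_bimodule_bimodule HX))).
split.
- exact: (MC3 HX).
- by move=> x1 x2 x3 x4 x5; rewrite (MC1 HX) (lformZr HX) -(MC2 HX).
- by move=> x1 x2 x3 x4 x5; rewrite (lformZr HX) -(MC2 HX) lM.
- move=> x y z; rewrite -!lM; congr lact.
  by apply: idem_comm; apply: (lform_idem HX).
- move=> x y z; rewrite !(MC7 HX) -!rM; congr ract.
  by apply: idem_comm; apply: (rform_idem HX).
Qed.
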